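(* Let $G$ be an Abelian group. Then $(G,\mathcal{PM}_G)$ is precompact if and only if for every non-discrete, non-precompact paratopological group topology $\tau$ on $G$ there is a paratopological group topology on $G$ transversal to $\tau$.
   Context: A paratopological group topology on a group $G$ is a topology for which multiplication is jointly continuous (no separation axiom is assumed). A paratopological group is precompact if it can be covered by finitely many translates of each neighborhood of the identity. Two non-discrete topologies on a set are transversal if their union generates the discrete topology. Let $\mathcal{PL}(G)$ be the poset, ordered by inclusion, of all paratopological group topologies on $G$ and $\delta_G$ the discrete topology. A maximal paratopological group topology on $G$ is a maximal element of $\mathcal{PL}(G)\setminus\{\delta_G\}$. The submaximal paratopological group topology $\mathcal{PM}_G$ is the infimum, in $\mathcal{PL}(G)$, of all maximal paratopological group topologies on $G$ (the infimum of the empty family being $\delta_G$). *)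

(* Defs.v *)
From HB Require Import structures.
From mathcomp Require Import all_boot all_algebra.
From mathcomp Require Import all_classical topology.

Set Implicit Arguments.
Unset Strict Implicit.
Unset Printing Implicit Defensive.

Import GRing.Theory.
Local Open Scope classical_set_scope.
Local Open Scope ring_scope.

(* MathComp-Analysis attaches one topology to each type.  Here topologies on a
   fixed type are first-class values, given by their families of open sets, and
   [topospace t] is the carrier equipped with [t] as its canonical topology. *)
Record is_topology (T : Type) (O : set (set T)) : Prop := IsTopology {
  topT : O setT ;
  topI : setI_closed O ;
  top_bigcup : forall F : set (set T), F `<=` O -> O (\bigcup_(A in F) A)
}.

Record topology_on (T : Type) := TopologyOn {
  opens :> set (set T) ;
  opensP : is_topology opens
}.

Definition topospace (T : Type) (t : topology_on T) : Type := T.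

Section SpaceTopology.
Context (T : choiceType) (t : topology_on T).

Let bigcup_opens (I : Type) (f : I -> set T) :
  (forall i, opens t (f i)) -> opens t (\bigcup_i f i).
Proof.
move=> fO; rewrite -(bigcup_image setT f id).
apply: (top_bigcup (opensP t)).
by move=> _ [i _ <-].
Qed.

HB.instance Definition _ := Choice.on (topospace t).
HB.instance Definition _ := isOpenTopological.Build (topospace t)
  (topT (opensP t)) (topI (opensP t)) bigcup_opens.

End SpaceTopology.

HB.instance Definition _ (G : zmodType) (t : topology_on G) :=
  GRing.Zmodule.on (topospace t).

Lemma open_topospaceE (T : choiceType) (t : topology_on T) :
  @open (topospace t) = opens t.
Proof. by []. Qed.

Lemma smallest_is_topology (T : Type) (B : set (set T)) :
  is_topology (smallest (@is_topology T) B).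
Proof.
split.
- by move=> O [/topT].
- by move=> U V BU BV O OB; apply: (topI OB.1); [exact: BU|exact: BV].
- move=> F FB O OB; apply: (top_bigcup OB.1) => A FA.
  exact: (FB _ FA).
Qed.

Definition generated_topology (T : Type) (B : set (set T)) : topology_on T :=
  TopologyOn (smallest_is_topology B).

Definition is_discrete (T : Type) (t : topology_on T) : Prop :=
  opens t = [set: set T].

Definition transversal_topologies (T : Type) (s t : topology_on T) : Prop :=
  [/\ ~ is_discrete s, ~ is_discrete t &
      is_discrete (generated_topology (opens s `|` opens t))].

Section Paratopological.
Context (G : zmodType).
Implicit Types (s t : topology_on G) (F : set (topology_on G)).

(* The poset PL(G), ordered by inclusion of the families of open sets. *)
Definition paratopological : set (topology_on G) :=
  [set t | continuous (fun z : topospace t * topospace t => z.1 + z.2 : topospace t)].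

Definition precompact_group t : Prop :=
  forall U : set (topospace t), nbhs (0 : topospace t) U ->
  exists2 S : set G, finite_set S & \bigcup_(x in S) ((+%R x) @` U) = setT.

Definition maximal_paratopological : set (topology_on G) :=
  [set t | [/\ paratopological t, ~ is_discrete t &
    forall s, paratopological s -> ~ is_discrete s ->
      opens t `<=` opens s -> opens s = opens t]].

Definition PL_lower_bounds F : set (topology_on G) :=
  [set s | paratopological s /\ forall t, F t -> opens s `<=` opens t].

Definition is_PL_infimum F s : Prop :=
  PL_lower_bounds F s /\
  forall r, PL_lower_bounds F r -> opens r `<=` opens s.

(* The infimum is realised as the join of all lower bounds; in general it is
   coarser than the intersection of the members of [F], which need not be
   a paratopological group topology. *)
Definition PL_infimum F : topology_on G :=
  generated_topology (\bigcup_(s in PL_lower_bounds F) opens s).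

Lemma paratopologicalP t : paratopological t <->
  forall W x y, opens t W -> W (x + y) -> exists U V,
    [/\ opens t U, opens t V, U x, V y & forall u v, U u -> V v -> W (u + v)].
Proof.
split=> [ct W x y oW Wxy|h].
- have /= := ct (x, y) W; rewrite nbhs_simpl /=.
  have nW : nbhs (x + y : topospace t) W by apply: open_nbhs_nbhs; split.
  move=> /(_ nW) [[U V]] [] /= nU nV UVW.
  move: nU nV; rewrite !nbhsE => -[U' [oU Ux] UU] [V' [oV Vy] VV].
  exists U', V'; split => // u v /UU Uu /VV Vv.
  exact: (UVW (u, v)).
- move=> [x y] W /=; rewrite nbhsE => -[W' [oW Wxy] WW].
  rewrite nbhs_simpl /=.
  have [U [V [oU oV Ux Vy UVW]]] := h W' x y oW Wxy.
  exists (U, V) => /=; first by split; apply: open_nbhs_nbhs.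
  by move=> [u v] /= [Uu Vv]; apply: WW; exact: UVW.
Qed.

Lemma PL_infimumP F : is_PL_infimum F (PL_infimum F).
Proof.
have sub r : PL_lower_bounds F r -> opens r `<=` opens (PL_infimum F).
  by move=> Fr A rA O [_]; apply; exists r.
split=> //; split; last first.
  move=> t Ft A; apply; split; first exact: opensP.
  by move=> B [s [_ /(_ _ Ft)]]; apply.
apply/paratopologicalP => W x y oW; move: W oW x y.
pose good (W : set G) := opens (PL_infimum F) W /\
  forall x y, W (x + y) -> exists U V,
    [/\ opens (PL_infimum F) U, opens (PL_infimum F) V, U x, V y &
        forall u v, U u -> V v -> W (u + v)].
have iT := opensP (PL_infimum F).
suff goodP : opens (PL_infimum F) `<=` good by move=> W /goodP [].
apply: smallest_sub; last first.
  move=> W [s Fs sW]; split; first exact: sub sW.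
  move=> x y Wxy; have [/paratopologicalP sp _] := Fs.
  have [U [V [oU oV Ux Vy UVW]]] := sp W x y sW Wxy.
  by exists U, V; split=> //; exact: (sub _ Fs).
split.
- by split=> [|x y _]; [exact: (topT iT)|exists setT, setT; split=> //; exact: (topT iT)].
- move=> A B [oA gA] [oB gB]; split; first exact: (topI iT).
  move=> x y [/gA [U [V [? ? ? ? UV]]] /gB [U' [V' [? ? ? ? UV']]]].
  exists (U `&` U'), (V `&` V'); split=> //; try exact: (topI iT).
  by move=> u v [? ?] [? ?]; split; [exact: UV|exact: UV'].
- move=> H Hg; split; first by apply: (top_bigcup iT) => A /Hg [].
  move=> x y [A HA Axy]; have [_ /(_ _ _ Axy)] := Hg _ HA.
  move=> [U [V [? ? ? ? UV]]]; exists U, V; split=> // u v Uu Vv.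
  by exists A => //; exact: UV.
Qed.

Lemma PL_infimum0 : is_discrete (PL_infimum set0).
Proof.
have dT : is_topology [set: set G] by split.
apply/seteqP; split=> // A _; have [_] := PL_infimumP set0.
apply; last exact: (I : opens (TopologyOn dT) A).
split=> //; apply/paratopologicalP => W x y _ Wxy.
by exists [set x], [set y]; split=> // u v -> ->.
Qed.

End Paratopological.

Definition submaximal (G : zmodType) : topology_on G :=
  PL_infimum (@maximal_paratopological G).

(* Main.v *)
(** If [t] has no transversal then every maximal topology [m] contains [t]:
    the join of [m] and [t] is again a paratopological group topology, it is
    not discrete, and so it equals [m].  Hence [t] is coarser than the
    submaximal topology, and precompactness passes to coarser topologies.
    Conversely, by Zorn's lemma every non-discrete topology is contained in a
    maximal one, hence is not transversal to the submaximal topology. *)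
Require Import Defs.
From mathcomp Require Import all_boot all_algebra.
From mathcomp Require Import all_classical topology.

Import GRing.Theory.
Local Open Scope classical_set_scope.
Local Open Scope ring_scope.

Lemma sub_generated_topology (T : Type) (B : set (set T)) :
  B `<=` opens (generated_topology B).
Proof. by move=> A BA O [_]; apply. Qed.

Lemma generated_topology_min (T : Type) (B : set (set T)) (t : topology_on T) :
  B `<=` opens t -> opens (generated_topology B) `<=` opens t.
Proof. by move=> Bt A; apply; split=> //; exact: opensP. Qed.

(** The sets satisfying the conclusion already form a topology: directedness handles binary
    intersections, nonemptiness handles the whole space. So the members' open sets are a base of the
    join, not just a subbase. *)
Lemma directed_generated_topologyP (T : Type) (F : set (topology_on T)) :
  F !=set0 ->
  (forall s t, F s -> F t -> exists r,
     [/\ F r, opens s `<=` opens r & opens t `<=` opens r]) ->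
  forall W, opens (generated_topology (\bigcup_(s in F) opens s)) W ->
  forall x, W x -> exists s U, [/\ F s, opens s U, U x & U `<=` W].
Proof.
move=> [s0 Fs0] dirF.
apply: (@smallest_sub _ _ _ [set W : set T | forall x, W x ->
  exists s U, [/\ F s, opens s U, U x & U `<=` W]]); last first.
  by move=> W [s Fs sW] x Wx; exists s, W; split.
split.
- by move=> x _; exists s0, setT; split=> //; exact: topT (opensP s0).
- move=> A B hA hB x [/hA [s [U [Fs sU Ux UA]]] /hB [t [V [Ft tV Vx VB]]]].
  have [r [Fr sr tr]] := dirF _ _ Fs Ft.
  exists r, (U `&` V); split=> //; last by apply: setISS.
  by apply: (topI (opensP r)); [exact: sr|exact: tr].
- move=> H hH x [A HA /(hH _ HA) [s [U [Fs sU Ux UA]]]].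
  by exists s, U; split=> // y /UA Ay; exists A.
Qed.

Section Paratopological.
Context {G : zmodType}.
Implicit Types (s t m : topology_on G) (F : set (topology_on G)).

(** The sets with open preimage under addition form a topology, so it is enough to test an open set
    of a single member, where that member's own continuity applies. *)
Lemma paratopological_join F : F `<=` @paratopological G ->
  paratopological (generated_topology (\bigcup_(s in F) opens s)).
Proof.
move=> Fp; set J := generated_topology _.
apply/continuousP => /=.
apply: (@smallest_sub _ _ _ [set W : set G |
  open ((fun z : topospace J * topospace J => z.1 + z.2) @^-1` W)]).
  split=> [|A B|H Hop] /=; first by rewrite preimage_setT; exact: openT.
    by rewrite preimage_setI; exact: openI.
  by rewrite preimage_bigcup; exact: bigcup_open.
move=> W [s Fs sW] /=; rewrite openE => -[x y] /= Wxy.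
have /paratopologicalP /(_ _ _ _ sW Wxy) := Fp _ Fs.
move=> [U [V [sU sV Ux Vy UVW]]].
exists (U, V) => /=; last by move=> [u v] /= [Uu Vv]; exact: UVW.
by split; apply: open_nbhs_nbhs; split=> //;
  apply: sub_generated_topology; exists s.
Qed.

Lemma discrete_opens0 t : paratopological t -> opens t [set 0] -> is_discrete t.
Proof.
move=> /paratopologicalP tp t0.
have open1 x : opens t [set x].
  (* Since [- x] lies in [V], each [u] in [U] satisfies [u - x = 0]; continuity of inversion is not
     assumed. *)
  have [|U [V [tU _ Ux Vx UV]]] := tp _ x (- x) t0; first exact: subrr.
  suff -> : [set x] = U by [].
  apply/seteqP; split=> [_ -> //|u Uu].
  by apply/eqP; rewrite -subr_eq0; apply/eqP; exact: UV.
apply/seteqP; split=> // A _.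
rewrite -[A]image_id -bigcup_imset1 -(bigcup_image _ _ id).
by apply: (top_bigcup (opensP t)) => _ [x _ <-].
Qed.

Lemma maximal_paratopological_exists t :
  paratopological t -> ~ is_discrete t ->
  exists2 m, maximal_paratopological m & opens t `<=` opens m.
Proof.
move=> tp tnd.
pose P s := [/\ paratopological s, ~ is_discrete s & opens t `<=` opens s].
have tP : P t by split.
pose R (a b : {s | P s}) := `[< opens (sval a) `<=` opens (sval b) >].
have [||A totA|m mmax] := @ZL_preorder _ (exist _ t tP) R.
- by move=> a; apply/asboolP.
- by move=> b a c /asboolP ab /asboolP bc; apply/asboolP => U /ab /bc.
(* Adjoining [t] keeps the family nonempty when the chain [A] is empty. *)
- pose F := t |` (sval @` A).
  have FP s : F s -> P s by move=> [->|[a _ <-]] //; exact: svalP.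
  have dirF s1 s2 : F s1 -> F s2 -> exists r,
      [/\ F r, opens s1 `<=` opens r & opens s2 `<=` opens r].
    move=> Fs1 Fs2; have [_ _ ts1] := FP _ Fs1; have [_ _ ts2] := FP _ Fs2.
    case: Fs1 => [->|[a Aa as1]]; first by exists s2; split.
    case: Fs2 => [->|[b Ab bs2]]; first by exists s1; split=> //; right; exists a.
    case: (totA _ _ Aa Ab) => /asboolP; rewrite as1 bs2 => le12.
      by exists s2; split=> //; right; exists b.
    by exists s1; split=> //; right; exists a.
  pose J := generated_topology (\bigcup_(s in F) opens s).
  have sFJ s : F s -> opens s `<=` opens J.
    by move=> Fs U sU; apply: sub_generated_topology; exists s.
  have JP : P J.
    split; last by apply: sFJ; left.
      by apply: paratopological_join => s /FP [].
    (* If the join were discrete, [[set 0]] would already be open in a single member, making that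
       member discrete. *)
    move=> Jd; have J0 : opens J [set 0] by rewrite Jd.
    have F0 : F !=set0 by exists t; left.
    have [s [U [Fs sU U0 Us]]] := directed_generated_topologyP _ _ F0 dirF _ J0 0 erefl.
    have [sp snd _] := FP _ Fs; apply: snd; apply: discrete_opens0 => //.
    by rewrite (_ : [set 0] = U) //; apply/seteqP; split=> // _ ->.
  exists (exist _ J JP) => a Aa; apply/asboolP; apply: sFJ.
  by right; exists a.
- have [mp mnd tm] := svalP m; exists (sval m) => //; split=> // s sp snd ms.
  have sP : P s by split=> // U /tm /ms.
  apply/seteqP; split=> //.
  have mR : R m (exist _ s sP) by apply/asboolP.
  exact: (asboolW (mmax _ mR)).
Qed.

Lemma precompact_group_coarser s t :
  opens s `<=` opens t -> precompact_group t -> precompact_group s.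
Proof.
move=> st tpc U; rewrite nbhsE => -[V [sV V0] VU].
have [|S finS SV] := tpc V; first by apply: open_nbhs_nbhs; split=> //; exact: st.
exists S => //; apply/seteqP; split=> // x _.
have : [set: G] x by [].
by rewrite -SV => -[y Sy [v Vv <-]]; exists y => //; exists v => //; exact: VU.
Qed.

(** Written as the join of the empty family, so that [paratopological_join] applies to it. *)
Definition indiscrete : topology_on G := generated_topology set0.

Lemma paratopological_indiscrete : paratopological indiscrete.
Proof.
by rewrite /indiscrete -(bigcup_set0 (@opens G)); exact: paratopological_join.
Qed.

Lemma indiscrete_precompact : precompact_group indiscrete.
Proof.
have indP : opens indiscrete `<=` [set U : set G | U !=set0 -> U = setT].
  apply: smallest_sub => //; split=> [//|A B hA hB [x [Ax Bx]]|H hH [x [A HA Ax]]].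
    have -> : A = setT by apply: hA; exists x.
    have -> : B = setT by apply: hB; exists x.
    exact: setIT.
  have AT : A = setT by apply: hH HA _; exists x.
  by apply/seteqP; split=> // y _; exists A => //; rewrite AT.
move=> U; rewrite nbhsE => -[V [oV V0] VU].
exists [set 0] => //; rewrite bigcup_set1; apply/seteqP; split=> // x _.
exists x; last exact: add0r.
by apply: VU; rewrite (indP _ oV) //; exists 0.
Qed.

End Paratopological.

Theorem theorem4p18 (G : zmodType) :
  precompact_group (submaximal G) <->
  (forall t : topology_on G,
     paratopological t -> ~ is_discrete t -> ~ precompact_group t ->
     exists s : topology_on G, paratopological s /\ transversal_topologies s t).
Proof.
have [[PMp PMle] PMmax] := PL_infimumP (@maximal_paratopological G).
split=> [PMpc t tp tnd tnpc|transv].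
  apply: contrapT => notransv; apply: tnpc.
  apply: (@precompact_group_coarser _ _ (submaximal G)) => //.
  apply: PMmax; split=> // m [mp mnd mmax].
  have Jp : paratopological (generated_topology (opens m `|` opens t)).
    have := @paratopological_join G [set m; t].
    by rewrite bigcup_setU !bigcup_set1; apply=> _ [->|->].
  have mtJ := @sub_generated_topology G (opens m `|` opens t).
  rewrite -(mmax _ Jp); first by move=> U tU; apply: mtJ; right.
    (* A discrete join would make [m] itself a transversal to [t]. *)
    by move=> Jd; apply: notransv; exists m.
  by move=> U mU; apply: mtJ; left.
apply: contrapT => PMnpc.
(* The hypothesis [transv] covers only non-discrete topologies. In the discrete case, either the
   indiscrete topology is discrete too, so its precompactness passes to [submaximal G], or it lies
   in a maximal topology, which then contains the discrete [submaximal G]. *)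
have [PMd|PMnd] := pselect (is_discrete (submaximal G)).
  have [id|ind] := pselect (is_discrete (@indiscrete G)).
    apply: PMnpc; apply: precompact_group_coarser indiscrete_precompact.
    by rewrite id.
  have [m mM _] := maximal_paratopological_exists _ paratopological_indiscrete ind.
  have [_ mnd _] := mM; apply: mnd; apply/seteqP; split=> //.
  by rewrite -PMd; exact: PMle.
have [s [sp [snd _ Jd]]] := transv _ PMp PMnd PMnpc.
have [m mM sm] := maximal_paratopological_exists _ sp snd.
have [_ mnd _] := mM; apply: mnd; apply/seteqP; split=> //.
(* [m] contains both [s] and [submaximal G], hence the discrete topology that they generate. *)
rewrite -Jd; apply: generated_topology_min.
by rewrite subUset; split=> //; exact: PMle.
Qed.
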